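(* Let $0<|q|<1$ and $a\in\mathbb C^\ast$, such that no denominator factors vanish. Let $\omega$ be a fixed primitive third root of unity. Then $${}_8W_7\left(a;\omega a,\omega^2a,q^{1/3},\omega q^{1/3},\omega^2q^{1/3};q,q\right)=\sum_{k=0}^\infty\frac{1-aq^{2k}}{1-a}\,\frac{(q,a^3;q^3)_k}{(q^3,q^2a^3;q^3)_k}\,q^k$$ $$=\frac{1}{(1-a)\,(q^2a^3;q^3)_\infty}\left(\frac{(q^2,qa^3;q^3)_\infty}{(q;q^3)_\infty}-\frac{a\,(q,q^3a^3;q^3)_\infty}{(q^3;q^3)_\infty}\;{}_2\phi_1\left(qa^3,q^3;q^3a^3;q^3,q\right)\right).$$
   Context: $\mathbb C^\ast=\mathbb C\setminus\{0\}$. For a base $p$ with $0<|p|<1$ (here $p=q$ or $p=q^3$): $(x;p)_\infty=\prod_{n\ge0}(1-xp^n)$, $(x;p)_k=(x;p)_\infty/(xp^k;p)_\infty$, $(x_1,\dots,x_m;p)_k=\prod_i(x_i;p)_k$ for $k\in\mathbb N_0\cup\{\infty\}$. ${}_2\phi_1(A,B;C;p,z)=\sum_{k\ge0}\frac{(A,B;p)_k}{(p,C;p)_k}z^k$. Very-well-poised series: $${}_8W_7(a;a_4,\dots,a_8;q,z)=\sum_{k=0}^\infty\frac{1-aq^{2k}}{1-a}\,\frac{(a;q)_k}{(q;q)_k}\prod_{j=4}^8\frac{(a_j;q)_k}{(qa/a_j;q)_k}\,z^k .$$ A fixed branch of $q^{1/3}$ is taken. *)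

(* Defs.v *)
From Stdlib Require Import Reals Lra Lia List.
From Coquelicot Require Import Coquelicot.
Import ListNotations.

Open Scope C_scope.

(* [iota] returns the unique complex number with the given property; these two
   operators are only meaningful when the limit, resp. the sum, exists. *)
Definition Clim_seq (u : nat -> C) : C :=
  iota (fun l : C_CompleteNormedModule => filterlim u eventually (locally l)).

Definition Cseries (a : nat -> C) : C :=
  iota (fun l : C_CompleteNormedModule => is_series a l).

Definition ex_Cseries (a : nat -> C) : Prop :=
  exists l : C_CompleteNormedModule, is_series a l.

(* (x;p)_k for finite k, as the finite product prod_{n<k} (1 - x p^n).  It is
   equal to the quotient (x;p)_oo / (x p^k;p)_oo whenever (x p^k;p)_oo <> 0
   (lemma [qpoch_quotient]); when (x p^k;p)_oo = 0 the quotient is 0/0 and the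
   finite product is its usual meaning, e.g. (1;p)_0 = 1. *)
Fixpoint qpoch (x p : C) (k : nat) : C :=
  match k with
  | O => 1
  | S n => qpoch x p n * (1 - x * p ^ n)
  end.

Definition qpoch_inf (x p : C) : C := Clim_seq (qpoch x p).

Fixpoint Cprod (l : list C) : C :=
  match l with
  | nil => 1
  | x :: l' => x * Cprod l'
  end.

(* (x_1,...,x_m;p)_k and (x_1,...,x_m;p)_oo *)
Definition qpochs (xs : list C) (p : C) (k : nat) : C :=
  Cprod (map (fun x => qpoch x p k) xs).

Definition qpochs_inf (xs : list C) (p : C) : C :=
  Cprod (map (fun x => qpoch_inf x p) xs).

Definition phi21_term (A B c p z : C) (k : nat) : C :=
  qpochs [A; B] p k / qpochs [p; c] p k * z ^ k.

Definition phi21 (A B c p z : C) : C := Cseries (phi21_term A B c p z).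

Definition W87_term (a a4 a5 a6 a7 a8 q z : C) (k : nat) : C :=
  (1 - a * q ^ (2 * k)) / (1 - a) * (qpoch a q k / qpoch q q k)
  * Cprod (map (fun aj => qpoch aj q k / qpoch (q * a / aj) q k)
             [a4; a5; a6; a7; a8])
  * z ^ k.

Definition W87 (a a4 a5 a6 a7 a8 q z : C) : C :=
  Cseries (W87_term a a4 a5 a6 a7 a8 q z).

Definition primitive_root (n : nat) (w : C) : Prop :=
  w ^ n = 1 /\ forall m : nat, (0 < m < n)%nat -> w ^ m <> 1.

Lemma Clim_seq_unique (u : nat -> C) (l : C_CompleteNormedModule) :
  filterlim u eventually (locally l) -> Clim_seq u = l.
Proof.
intros H.
exact (iota_filterlim_locally (V := C_CompleteNormedModule) (F := eventually) u l H).
Qed.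

Lemma Cseries_unique (a : nat -> C) (l : C_CompleteNormedModule) :
  is_series a l -> Cseries a = l.
Proof.
intros H.
exact (iota_filterlim_locally (V := C_CompleteNormedModule) (F := eventually)
         (sum_n a) l H).
Qed.

Lemma qpoch_add (x p : C) (k n : nat) :
  qpoch x p (k + n) = qpoch x p k * qpoch (x * p ^ k) p n.
Proof.
induction n as [|n IH].
- rewrite Nat.add_0_r; simpl; ring.
- rewrite Nat.add_succ_r; cbn [qpoch]; rewrite IH, Cpow_add_r; ring.
Qed.

Lemma qpoch_bound (x p : C) (n : nat) : (Cmod p < 1)%R ->
  (Cmod (qpoch x p n) <= exp (Cmod x * (1 - Cmod p ^ n) / (1 - Cmod p)))%R.
Proof.
intros Hp; induction n as [|n IH].
- simpl; rewrite Cmod_1; right.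
  replace (Cmod x * (1 - 1) / (1 - Cmod p))%R with 0%R by (field; lra).
  now rewrite exp_0.
- cbn [qpoch]; rewrite Cmod_mult.
  replace (Cmod x * (1 - Cmod p ^ S n) / (1 - Cmod p))%R
    with (Cmod x * (1 - Cmod p ^ n) / (1 - Cmod p) + Cmod x * Cmod p ^ n)%R
    by (simpl; field; lra).
  rewrite exp_plus.
  apply Rmult_le_compat; try apply Cmod_ge_0; [exact IH|].
  apply Rle_trans with (1 + Cmod x * Cmod p ^ n)%R.
  + unfold Cminus; eapply Rle_trans; [apply Cmod_triangle|].
    rewrite Cmod_1, Cmod_opp, Cmod_mult, Cmod_pow; lra.
  + apply exp_ineq1_le.
Qed.

Lemma qpoch_cvg (x p : C) : (Cmod p < 1)%R ->
  exists l : C_CompleteNormedModule, filterlim (qpoch x p) eventually (locally l).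
Proof.
intros Hp.
set (d := fun k => - (qpoch x p k * (x * p ^ k))).
assert (Hd : exists l : C_CompleteNormedModule, is_series d l).
{ apply (ex_series_le (V := C_CompleteNormedModule) d
           (fun k => exp (Cmod x / (1 - Cmod p)) * Cmod x * Cmod p ^ k)%R).
  - intros n; change (norm (d n)) with (Cmod (d n)).
    unfold d; rewrite Cmod_opp, !Cmod_mult, Cmod_pow, Rmult_assoc.
    assert (H0 := Cmod_ge_0 p); assert (H1 := Cmod_ge_0 x).
    assert (H2 : (0 <= Cmod p ^ n)%R) by now apply pow_le.
    apply Rmult_le_compat_r; [now apply Rmult_le_pos|].
    eapply Rle_trans; [now apply qpoch_bound|].
    assert (H3 : (Cmod x * (1 - Cmod p ^ n) / (1 - Cmod p)
                  <= Cmod x / (1 - Cmod p))%R).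
    { apply Rmult_le_compat_r; [left; apply Rinv_0_lt_compat; lra | nra]. }
    destruct H3 as [H3 | ->]; [left; now apply exp_increasing | right; reflexivity].
  - apply (ex_series_scal (V := R_NormedModule)).
    apply ex_series_geom; rewrite Rabs_pos_eq; [exact Hp | apply Cmod_ge_0]. }
destruct Hd as [l Hl].
exists (plus (1 : C) l).
assert (Hs : forall n, qpoch x p (S n) = 1 + sum_n d n).
{ induction n as [|n IH].
  - rewrite sum_O; unfold d; simpl; ring.
  - rewrite sum_Sn; change (qpoch x p (S (S n)))
      with (qpoch x p (S n) * (1 - x * p ^ S n)).
    change (plus (sum_n d n) (d (S n))) with (sum_n d n + d (S n)).
    rewrite Cplus_assoc, <- IH; unfold d; ring. }
intros P HP.
assert (Ht : filterlim (fun n => plus (1 : C) (sum_n d n)) eventually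
               (locally (plus (1 : C) l))).
{ apply (filterlim_comp_2 (fun _ : nat => (1 : C)) (sum_n d)
           (@plus C_AbelianGroup) (G := locally (1 : C)) (H := locally l)).
  - apply filterlim_const.
  - exact Hl.
  - exact (filterlim_plus (V := C_NormedModule) (1 : C) l). }
destruct (Ht P HP) as [N HN].
exists (S N); intros [|n] Hn; [lia|].
rewrite Hs; apply HN; lia.
Qed.

Lemma qpoch_inf_correct (x p : C) : (Cmod p < 1)%R ->
  filterlim (qpoch x p) eventually (locally (qpoch_inf x p)).
Proof.
intros Hp; destruct (qpoch_cvg x p Hp) as [l Hl].
unfold qpoch_inf; rewrite (Clim_seq_unique _ l Hl); exact Hl.
Qed.

Lemma qpoch_inf_split (x p : C) (k : nat) : (Cmod p < 1)%R ->
  qpoch_inf x p = qpoch x p k * qpoch_inf (x * p ^ k) p.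
Proof.
intros Hp.
apply (Clim_seq_unique (qpoch x p)).
intros P HP.
assert (Ht : filterlim (fun n => scal (qpoch x p k) (qpoch (x * p ^ k) p n))
               eventually
               (locally (scal (qpoch x p k) (qpoch_inf (x * p ^ k) p)))).
{ apply (filterlim_comp _ _ _ (qpoch (x * p ^ k) p)
           (fun y : C_NormedModule => scal (qpoch x p k) y)
           eventually (locally (qpoch_inf (x * p ^ k) p))).
  - now apply qpoch_inf_correct.
  - apply (filterlim_scal_r (V := C_NormedModule)). }
destruct (Ht P HP) as [N HN].
exists (k + N)%nat; intros n Hn.
replace n with (k + (n - k))%nat by lia.
rewrite qpoch_add; apply HN; lia.
Qed.

Lemma qpoch_quotient (x p : C) (k : nat) : (Cmod p < 1)%R ->
  qpoch_inf (x * p ^ k) p <> 0 ->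
  qpoch x p k = qpoch_inf x p / qpoch_inf (x * p ^ k) p.
Proof.
intros Hp Hk; rewrite (qpoch_inf_split x p k Hp); field; exact Hk.
Qed.

(* Main.v *)
(* The cubic products over the third roots of unity turn the 8W7 termwise into
   the middle series.  Splitting the factor [1 - a q^(2k)] there gives two 2phi1
   series in base [q^3] with parameters [q, a^3; q^2 a^3] and arguments [q] and
   [q^3].  Heine's transformation, obtained from the q-binomial theorem by
   exchanging a double sum, applies to both: at argument [q] it collapses to a
   1phi0 (the q-Gauss sum), at argument [q^3] it gives the 2phi1 on the right. *)
Require Import Defs.
From Stdlib Require Import Reals Lra Lia List Classical.
From Coquelicot Require Import Coquelicot.
Import ListNotations.
Open Scope C_scope.

(** * Limits of complex sequences through their moduli *)

Notation is_Clim u l := (filterlim u eventually (@locally C_NormedModule l)).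
Notation is_Cseries := (@is_series C_AbsRing C_NormedModule).

(** Reduces complex limits to real ones, where squeezing and order comparison are available. *)
Lemma is_Clim_Cmod (u : nat -> C) (l : C) :
  is_Clim u l <-> is_lim_seq (fun n => Cmod (u n - l)) 0.
Proof.
split; intros H.
- apply is_lim_seq_spec; intros eps.
  destruct (proj1 (filterlim_locally_ball_norm (U := C_NormedModule) u l) H eps)
    as [N HN].
  exists N; intros n Hn.
  rewrite Rminus_0_r, Rabs_pos_eq by apply Cmod_ge_0.
  exact (HN n Hn).
- apply (proj2 (filterlim_locally_ball_norm (U := C_NormedModule) u l)).
  intros eps; apply is_lim_seq_spec in H; destruct (H eps) as [N HN].
  exists N; intros n Hn; specialize (HN n Hn).
  rewrite Rminus_0_r, Rabs_pos_eq in HN by apply Cmod_ge_0.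
  exact HN.
Qed.

Lemma is_Clim_unique (u : nat -> C) (l l' : C) :
  is_Clim u l -> is_Clim u l' -> l = l'.
Proof. exact (filterlim_locally_unique (V := C_NormedModule) u l l'). Qed.

Lemma is_Clim_geom (u : nat -> C) (l : C) (K t : R) :
  (0 <= t < 1)%R -> (forall n, (Cmod (u n - l) <= K * t ^ n)%R) -> is_Clim u l.
Proof.
intros Ht Hu; apply is_Clim_Cmod.
apply (is_lim_seq_le_le (fun _ => 0%R) _ (fun n => (K * t ^ n)%R)).
- intros n; split; [apply Cmod_ge_0 | apply Hu].
- apply is_lim_seq_const.
- replace (Finite 0) with (Rbar_mult K 0) by (simpl; f_equal; ring).
  apply is_lim_seq_scal_l, is_lim_seq_geom; rewrite Rabs_pos_eq; lra.
Qed.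

Lemma is_Clim_Cmod_le (u : nat -> C) (l : C) (K : R) :
  is_Clim u l -> (forall n, (Cmod (u n) <= K)%R) -> (Cmod l <= K)%R.
Proof.
intros H Hu; apply is_Clim_Cmod in H.
assert (H1 : is_lim_seq (fun n => K + Cmod (u n - l))%R (K + 0)%R).
{ apply is_lim_seq_plus'; [apply is_lim_seq_const | exact H]. }
rewrite Rplus_0_r in H1.
refine (is_lim_seq_le (fun _ => Cmod l) _ (Cmod l) K _ (is_lim_seq_const _) H1).
intros n; replace l with (u n + - (u n - l)) at 1 by ring.
eapply Rle_trans; [apply Cmod_triangle|]; rewrite Cmod_opp.
specialize (Hu n); lra.
Qed.

Lemma is_Clim_Cmod_ge (u : nat -> C) (l : C) (K : R) :
  is_Clim u l -> (forall n, (K <= Cmod (u n))%R) -> (K <= Cmod l)%R.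
Proof.
intros H Hu; apply is_Clim_Cmod in H.
assert (H1 : is_lim_seq (fun n => Cmod l + Cmod (u n - l))%R (Cmod l + 0)%R).
{ apply is_lim_seq_plus'; [apply is_lim_seq_const | exact H]. }
rewrite Rplus_0_r in H1.
refine (is_lim_seq_le (fun _ => K) _ K (Cmod l) _ (is_lim_seq_const _) H1).
intros n; eapply Rle_trans; [apply Hu|].
replace (u n) with (l + (u n - l)) at 1 by ring; apply Cmod_triangle.
Qed.

Lemma is_Clim_scal (u : nat -> C) (l c : C) :
  is_Clim u l -> is_Clim (fun n => c * u n) (c * l).
Proof.
intros H.
exact (filterlim_comp _ _ _ u (fun y : C_NormedModule => scal c y) _ _ _ H
         (filterlim_scal_r (V := C_NormedModule) c l)).
Qed.

(** The difference tends to 0 by squeezing. This form identifies two limits whose sequences agree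
    only asymptotically, as in the proof of the q-binomial theorem. *)
Lemma is_Clim_geom_close (u v : nat -> C) (l l' : C) (K t : R) :
  (0 <= t < 1)%R -> is_Clim u l -> is_Clim v l' ->
  (forall n, (Cmod (u n - v n) <= K * t ^ n)%R) -> l = l'.
Proof.
intros Ht Hu Hv Huv.
assert (H0 : is_Clim (fun n => u n - v n) (RtoC 0)).
{ apply is_Clim_geom with K t; [exact Ht|]; intros n.
  replace (u n - v n - 0) with (u n - v n) by ring; apply Huv. }
assert (H1 : is_Clim (fun n => (u n - v n) + v n) (0 + l')).
{ exact (filterlim_comp_2 _ _ _ H0 Hv
           (filterlim_plus (V := C_NormedModule) (RtoC 0) l')). }
rewrite Cplus_0_l in H1; refine (is_Clim_unique u l l' Hu _).
refine (filterlim_ext _ _ _ H1); intros n; simpl; ring.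
Qed.

(** * Complex series: algebra, geometric majorants, exchange of summations *)

Lemma is_Cseries_unique (a : nat -> C) (l l' : C) :
  is_Cseries a l -> is_Cseries a l' -> l = l'.
Proof. exact (is_Clim_unique (sum_n a) l l'). Qed.

Lemma is_Cseries_scal (c : C) (a : nat -> C) (l : C) :
  is_Cseries a l -> is_Cseries (fun n => c * a n) (c * l).
Proof. exact (is_series_scal (V := C_NormedModule) c a l). Qed.

Lemma is_Cseries_plus (a b : nat -> C) (la lb : C) :
  is_Cseries a la -> is_Cseries b lb ->
  is_Cseries (fun n => a n + b n) (la + lb).
Proof. exact (is_series_plus (V := C_NormedModule) a b la lb). Qed.

Lemma is_Cseries_minus (a b : nat -> C) (la lb : C) :
  is_Cseries a la -> is_Cseries b lb ->
  is_Cseries (fun n => a n - b n) (la - lb).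
Proof. exact (is_series_minus (V := C_NormedModule) a b la lb). Qed.

Lemma is_Cseries_ext (a b : nat -> C) (l : C) :
  (forall n, a n = b n) -> is_Cseries a l -> is_Cseries b l.
Proof. exact (is_series_ext (V := C_NormedModule) a b l). Qed.

(** The partial sum [sum_n a n] includes the index [n], so the remaining tail starts at [S n]. *)
Lemma is_Cseries_shift (a : nat -> C) (n : nat) (l : C) :
  is_Cseries a l -> is_Cseries (fun k => a (S n + k)%nat) (l - sum_n a n).
Proof.
intros H; apply (is_series_incr_n (V := C_NormedModule) a (S n)); [lia|].
simpl pred; change (is_Cseries a (l - sum_n a n + sum_n a n)).
now replace (l - sum_n a n + sum_n a n) with l by ring.
Qed.

Lemma is_Cseries_shift1 (a : nat -> C) (l : C) :
  is_Cseries a l -> is_Cseries (fun k => a (S k)) (l - a O).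
Proof. intros H; rewrite <- (sum_O a); exact (is_Cseries_shift a 0 l H). Qed.

Lemma ex_Cseries_geom (a : nat -> C) (K t : R) :
  (0 <= t < 1)%R -> (forall n, (Cmod (a n) <= K * t ^ n)%R) ->
  exists l : C, is_Cseries a l.
Proof.
intros Ht Ha.
apply (ex_series_le (V := C_CompleteNormedModule) a (fun n => K * t ^ n)%R).
- exact Ha.
- apply (ex_series_scal (V := R_NormedModule)), ex_series_geom.
  rewrite Rabs_pos_eq; lra.
Qed.

Lemma is_Cseries_geom_le (a : nat -> C) (l : C) (K t : R) :
  (0 <= t < 1)%R -> (forall n, (Cmod (a n) <= K * t ^ n)%R) ->
  is_Cseries a l -> (Cmod l <= K / (1 - t))%R.
Proof.
intros Ht Ha H.
assert (HK : (0 <= K)%R).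
{ specialize (Ha O); simpl in Ha; pose proof (Cmod_ge_0 (a O)); lra. }
assert (Hs : forall n, (Cmod (sum_n a n) <= K * (1 - t ^ S n) / (1 - t))%R).
{ induction n as [|n IH].
  - rewrite sum_O; specialize (Ha O); simpl in *.
    replace (K * (1 - t * 1) / (1 - t))%R with K by (field; lra); lra.
  - rewrite sum_Sn; eapply Rle_trans; [apply Cmod_triangle|].
    specialize (Ha (S n)).
    replace (K * (1 - t ^ S (S n)) / (1 - t))%R
      with (K * (1 - t ^ S n) / (1 - t) + K * t ^ S n)%R
      by (simpl; field; lra); lra. }
apply (is_Clim_Cmod_le (sum_n a)); [exact H|]; intros n.
eapply Rle_trans; [apply Hs|].
apply Rmult_le_compat_r; [left; apply Rinv_0_lt_compat; lra|].
assert (0 <= t ^ S n)%R by (apply pow_le; lra); nra.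
Qed.

(** Summing the first n + 1 columns amounts to summing over m the rows truncated at n. The error
    against [l] is therefore the sum of the row tails. The tail of row m is at most K s^m t^(n+1) /
    (1-t), so the total error is at most K t^(n+1) / ((1-t)(1-s)) and tends to 0. *)
Lemma is_Cseries_exchange (f : nat -> nat -> C) (r c : nat -> C) (l : C)
  (K s t : R) :
  (0 <= s < 1)%R -> (0 <= t < 1)%R ->
  (forall m k, (Cmod (f m k) <= K * s ^ m * t ^ k)%R) ->
  (forall m, is_Cseries (f m) (r m)) ->
  (forall k, is_Cseries (fun m => f m k) (c k)) ->
  is_Cseries r l -> is_Cseries c l.
Proof.
intros Hs Ht Hf Hr Hc Hl.
assert (Hpart : forall n, is_Cseries (fun m => sum_n (f m) n) (sum_n c n)).
{ induction n as [|n IH].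
  - rewrite sum_O; refine (is_Cseries_ext _ _ _ _ (Hc O)).
    intros m; now rewrite sum_O.
  - rewrite sum_Sn; refine (is_Cseries_ext _ _ _ _ (is_Cseries_plus _ _ _ _ IH (Hc (S n)))).
    intros m; now rewrite sum_Sn. }
apply is_Clim_geom with (K * t / (1 - t) / (1 - s))%R t; [exact Ht|]; intros n.
change (Cmod (sum_n c n - l) <= K * t / (1 - t) / (1 - s) * t ^ n)%R.
replace (sum_n c n - l) with (- (l - sum_n c n)) by ring; rewrite Cmod_opp.
replace (K * t / (1 - t) / (1 - s) * t ^ n)%R
  with (K * t ^ S n / (1 - t) / (1 - s))%R by (simpl; field; lra).
refine (is_Cseries_geom_le _ _ _ s Hs _ (is_Cseries_minus _ _ _ _ Hl (Hpart n))).
intros m.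
replace (K * t ^ S n / (1 - t) * s ^ m)%R
  with (K * s ^ m * t ^ S n / (1 - t))%R by (field; lra).
refine (is_Cseries_geom_le _ _ _ t Ht _ (is_Cseries_shift _ n _ (Hr m))).
intros k; rewrite Rmult_assoc, <- pow_add; apply Hf.
Qed.

(** * Bounds and nonvanishing for q-Pochhammer symbols *)

Lemma qpoch_le_exp (x p : C) (n : nat) : (Cmod p < 1)%R ->
  (Cmod (qpoch x p n) <= exp (Cmod x / (1 - Cmod p)))%R.
Proof.
intros Hp; eapply Rle_trans; [now apply qpoch_bound|].
assert (H : (Cmod x * (1 - Cmod p ^ n) / (1 - Cmod p)
             <= Cmod x / (1 - Cmod p))%R).
{ apply Rmult_le_compat_r; [left; apply Rinv_0_lt_compat; lra|].
  assert (H1 := Cmod_ge_0 x).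
  assert (H2 : (0 <= Cmod p ^ n)%R) by apply pow_le, Cmod_ge_0; nra. }
destruct H as [H | ->]; [left; now apply exp_increasing | right; reflexivity].
Qed.

(** A product of factors 1 - x_i with small x_i is at least 1 minus the sum of the |x_i|. Here that
    sum is d (1 - |p|^n) with d = |x|/(1-|p|); the induction needs this exact partial sum rather
    than its bound d. *)
Lemma qpoch_ge_half (x p : C) (n : nat) : (Cmod p < 1)%R ->
  (Cmod x / (1 - Cmod p) <= 1 / 2)%R -> (1 / 2 <= Cmod (qpoch x p n))%R.
Proof.
intros Hp Hx; set (d := (Cmod x / (1 - Cmod p))%R) in *.
assert (Hxd : Cmod x = (d * (1 - Cmod p))%R) by (unfold d; field; lra).
assert (Hx0 := Cmod_ge_0 x); assert (Hp0 := Cmod_ge_0 p).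
assert (Hd : (0 <= d)%R) by (apply Rmult_le_pos; [lra | left; apply Rinv_0_lt_compat; lra]).
clearbody d.
enough (H : (1 - d * (1 - Cmod p ^ n) <= Cmod (qpoch x p n))%R).
{ assert (0 <= d * Cmod p ^ n)%R by now apply Rmult_le_pos, pow_le.
  lra. }
induction n as [|n IH]; [simpl; rewrite Cmod_1; lra|].
cbn [qpoch]; rewrite Cmod_mult.
assert (Hpn : (0 <= Cmod p ^ n <= 1)%R).
{ split; [now apply pow_le | rewrite <- (pow1 n); apply pow_incr; lra]. }
assert (Hf : (1 - Cmod x * Cmod p ^ n <= Cmod (1 - x * p ^ n))%R).
{ rewrite <- Cmod_pow, <- Cmod_mult.
  pose proof (Cmod_triangle (1 - x * p ^ n) (x * p ^ n)) as H.
  replace (1 - x * p ^ n + x * p ^ n) with (RtoC 1) in H by ring.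
  rewrite Cmod_1 in H; lra. }
set (y := (Cmod p ^ n)%R) in *.
apply Rle_trans with ((1 - d * (1 - y)) * (1 - Cmod x * y))%R.
- change (Cmod p ^ S n)%R with (Cmod p * y)%R; rewrite Hxd.
  (* Since |x| = d (1-|p|), expanding the product gives 1 - d (1 - |p| y) plus exactly this
     nonnegative term. *)
  assert (0 <= (d * (1 - y)) * (d * (1 - Cmod p) * y))%R.
  { repeat apply Rmult_le_pos; lra. }
  lra.
- assert (d * (1 - y) <= 1 / 2 * 1)%R by (apply Rmult_le_compat; lra).
  assert (Cmod x * y <= 1 * 1)%R by (apply Rmult_le_compat; nra).
  apply Rmult_le_compat; [lra | lra | exact IH | exact Hf].
Qed.

Lemma qpoch_neq0 (x p : C) (n : nat) :
  (forall k, 1 - x * p ^ k <> 0) -> qpoch x p n <> 0.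
Proof.
intros H; induction n as [|n IH]; simpl.
- apply C1_nz.
- now apply Cmult_neq_0.
Qed.

(** Choose N so large that every product starting at x p^N has modulus at least 1/2. Beyond N, split
    the product at N. Below N, (x)_N is (x)_n times a factor bounded above by the exponential E,
    which bounds (x)_n from below. The constant |(x)_N| / (2E) serves both cases because E >= 1. *)
Lemma qpoch_bounded_below (x p : C) : (Cmod p < 1)%R ->
  (forall k, 1 - x * p ^ k <> 0) ->
  exists d : R, (0 < d)%R /\ forall n, (d <= Cmod (qpoch x p n))%R.
Proof.
intros Hp Hx.
assert (Hp0 := Cmod_ge_0 p); assert (Hx0 := Cmod_ge_0 x).
assert (HN : exists N, (Cmod (x * p ^ N) / (1 - Cmod p) <= 1 / 2)%R).
{ assert (Hl : is_lim_seq (fun n => Cmod x / (1 - Cmod p) * Cmod p ^ n)%R 0).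
  { replace (Finite 0) with (Rbar_mult (Cmod x / (1 - Cmod p))%R 0)
      by (simpl; f_equal; ring).
    apply is_lim_seq_scal_l, is_lim_seq_geom; rewrite Rabs_pos_eq; lra. }
  apply is_lim_seq_spec in Hl.
  destruct (Hl (mkposreal (1 / 2) ltac:(lra))) as [N HN].
  exists N; specialize (HN N (le_n N)); simpl in HN.
  rewrite Rminus_0_r in HN; apply Rabs_def2 in HN.
  rewrite Cmod_mult, Cmod_pow.
  replace (Cmod x * Cmod p ^ N / (1 - Cmod p))%R
    with (Cmod x / (1 - Cmod p) * Cmod p ^ N)%R by (field; lra); lra. }
destruct HN as [N HN].
assert (H0 : (0 < Cmod (qpoch x p N))%R) by now apply Cmod_gt_0, qpoch_neq0.
set (E := exp (Cmod x / (1 - Cmod p))).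
assert (HE : (1 <= E)%R).
{ rewrite <- exp_0; assert (H1 : (0 <= Cmod x / (1 - Cmod p))%R).
  { apply Rmult_le_pos; [lra | left; apply Rinv_0_lt_compat; lra]. }
  destruct H1 as [H1 | H1]; [left; now apply exp_increasing|].
  unfold E; rewrite <- H1; lra. }
exists (Cmod (qpoch x p N) / (2 * E))%R; split.
{ apply Rdiv_lt_0_compat; lra. }
intros n; apply Rle_div_l; [lra|].
assert (Hn := Cmod_ge_0 (qpoch x p n)).
destruct (Nat.le_ge_cases n N) as [Hle | Hle].
- replace N with (n + (N - n))%nat by lia.
  rewrite qpoch_add, Cmod_mult.
  apply Rmult_le_compat_l; [exact Hn|].
  apply Rle_trans with E; [|lra].
  eapply Rle_trans; [now apply qpoch_le_exp|].
  rewrite Cmod_mult, Cmod_pow.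
  assert (Hpn : (Cmod x * Cmod p ^ n / (1 - Cmod p) <= Cmod x / (1 - Cmod p))%R).
  { apply Rmult_le_compat_r; [left; apply Rinv_0_lt_compat; lra|].
    assert (Cmod p ^ n <= 1)%R by (rewrite <- (pow1 n); apply pow_incr; lra).
    nra. }
  unfold E; destruct Hpn as [Hpn | ->];
    [left; now apply exp_increasing | right; reflexivity].
- replace n with (N + (n - N))%nat by lia.
  rewrite qpoch_add, Cmod_mult.
  pose proof (qpoch_ge_half (x * p ^ N) p (n - N) Hp HN) as Hh.
  set (h := Cmod (qpoch (x * p ^ N) p (n - N))) in *.
  assert (Hh2 : (1 <= h * (2 * E))%R) by nra.
  rewrite Rmult_assoc, <- (Rmult_1_r (Cmod (qpoch x p N))) at 1.
  apply Rmult_le_compat_l; lra.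
Qed.

Lemma qpoch_inf_neq0 (x p : C) : (Cmod p < 1)%R ->
  (forall k, 1 - x * p ^ k <> 0) -> qpoch_inf x p <> 0.
Proof.
intros Hp Hx H0.
destruct (qpoch_bounded_below x p Hp Hx) as [d [Hd Hn]].
pose proof (is_Clim_Cmod_ge _ _ d (qpoch_inf_correct x p Hp) Hn) as H.
rewrite H0, Cmod_0 in H; lra.
Qed.

Lemma Cmod_mult_pow_le (x p : C) (n : nat) : (Cmod p < 1)%R ->
  (Cmod (x * p ^ n) <= Cmod x)%R.
Proof.
intros Hp; rewrite Cmod_mult, Cmod_pow.
assert (Hp0 := Cmod_ge_0 p); assert (Hx0 := Cmod_ge_0 x).
assert (Cmod p ^ n <= 1)%R by (rewrite <- (pow1 n); apply pow_incr; lra).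
nra.
Qed.

Lemma one_minus_mult_pow_neq0 (x p : C) : (Cmod p < 1)%R -> (Cmod x < 1)%R ->
  forall n, 1 - x * p ^ n <> 0.
Proof.
intros Hp Hx n H.
pose proof (Cmod_mult_pow_le x p n Hp) as H1.
replace (x * p ^ n) with (RtoC 1 - (1 - x * p ^ n)) in H1 by ring.
rewrite H in H1; replace (RtoC 1 - 0) with (RtoC 1) in H1 by ring.
rewrite Cmod_1 in H1; lra.
Qed.

(** Supplies the constants of the geometric majorants for all the basic hypergeometric series
    below. *)
Lemma qpoch_ratio_bounded (x y p : C) : (Cmod p < 1)%R ->
  (forall k, 1 - y * p ^ k <> 0) ->
  exists K : R, (0 <= K)%R /\
    forall n, (Cmod (qpoch x p n / qpoch y p n) <= K)%R.
Proof.
intros Hp Hy.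
destruct (qpoch_bounded_below y p Hp Hy) as [d [Hd Hn]].
pose proof (exp_pos (Cmod x / (1 - Cmod p))) as HE.
exists (exp (Cmod x / (1 - Cmod p)) / d)%R; split.
{ left; now apply Rdiv_lt_0_compat. }
intros n; rewrite Cmod_div by now apply qpoch_neq0.
apply Rmult_le_compat; [apply Cmod_ge_0 | | now apply qpoch_le_exp | ].
- left; apply Rinv_0_lt_compat; specialize (Hn n); lra.
- apply Rinv_le_contravar; [exact Hd | apply Hn].
Qed.

(** * The q-binomial theorem and Heine's transformation *)

(** With c_n = (a)_n/(p)_n, the recurrence c_(n+1) (1 - p^(n+1)) = c_n (1 - a p^n) says termwise
    that f(y) - f(yp) = y f(y) - a y f(yp). *)
Lemma qbinomial_functional (a p y l l' : C) : (Cmod p < 1)%R ->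
  is_Cseries (fun n => qpoch a p n / qpoch p p n * y ^ n) l ->
  is_Cseries (fun n => qpoch a p n / qpoch p p n * (y * p) ^ n) l' ->
  l * (1 - y) = (1 - a * y) * l'.
Proof.
intros Hp Hl Hl'.
pose proof (one_minus_mult_pow_neq0 p p Hp Hp) as Hpp.
pose proof (is_Cseries_shift1 _ _ (is_Cseries_minus _ _ _ _ Hl Hl')) as H1.
pose proof (is_Cseries_minus _ _ _ _ (is_Cseries_scal y _ _ Hl)
              (is_Cseries_scal (a * y) _ _ Hl')) as H2.
cbv beta in H1, H2.
(* The subtracted 0 is the term of index 0 of the difference series, which the shift removes: both
   constant terms are 1. *)
assert (H : l - l' - 0 = y * l - a * y * l').
{ refine (is_Cseries_unique _ _ _ _ H2).
  match type of H1 with is_series _ ?L => replace (l - l' - 0) with L end.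
  2: { simpl; field; apply C1_nz. }
  refine (is_Cseries_ext _ _ _ _ H1); intros n.
  cbn [qpoch]; rewrite !Cpow_mult_l, !Cpow_S.
  field; split; [now apply qpoch_neq0 | apply Hpp]. }
replace (l * (1 - y)) with (l - l' - 0 - y * l + l') by ring.
rewrite H; ring.
Qed.

(** Iterating the functional equation gives f(z) (z)_n = (az)_n f(z p^n). Since f(z p^n) tends to 1,
    letting n grow gives f(z) (z)_oo = (az)_oo. *)
Lemma qbinomial (a p z : C) : (Cmod p < 1)%R -> (Cmod z < 1)%R ->
  is_Cseries (fun n => qpoch a p n / qpoch p p n * z ^ n)
    (qpoch_inf (a * z) p / qpoch_inf z p).
Proof.
intros Hp Hz.
pose proof (one_minus_mult_pow_neq0 p p Hp Hp) as Hpp.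
destruct (qpoch_ratio_bounded a p p Hp Hpp) as [K [HK0 HK]].
set (term := fun y n => qpoch a p n / qpoch p p n * y ^ n).
set (f := fun y => Cseries (term y)).
assert (Hterm : forall y n, (Cmod (term y n) <= K * Cmod y ^ n)%R).
{ intros y n; unfold term; rewrite Cmod_mult, Cmod_pow.
  apply Rmult_le_compat_r; [apply pow_le, Cmod_ge_0 | apply HK]. }
assert (Hf : forall y, (Cmod y < 1)%R -> is_Cseries (term y) (f y)).
{ intros y Hy; destruct (ex_Cseries_geom (term y) K (Cmod y)) as [l Hl].
  - split; [apply Cmod_ge_0 | exact Hy].
  - apply Hterm.
  - unfold f; now rewrite (Cseries_unique _ l Hl). }
assert (Hy : forall n, (Cmod (z * p ^ n) <= Cmod z)%R)
  by (intros n; now apply Cmod_mult_pow_le).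
assert (Hrec : forall n,
          f z * qpoch z p n = qpoch (a * z) p n * f (z * p ^ n)).
{ induction n as [|n IH].
  - simpl; rewrite !Cmult_1_r; ring.
  - cbn [qpoch]; rewrite Cmult_assoc, IH.
    assert (E : z * p ^ S n = z * p ^ n * p) by (rewrite Cpow_S; ring).
    pose proof (Hf (z * p ^ n) (Rle_lt_trans _ _ _ (Hy n) Hz)) as F1.
    pose proof (Hf (z * p ^ S n) (Rle_lt_trans _ _ _ (Hy (S n)) Hz)) as F2.
    rewrite E in F2 |- *.
    pose proof (qbinomial_functional a p _ _ _ Hp F1 F2) as F.
    rewrite <- Cmult_assoc, F; ring. }
(* With y = z p^n, the term of index k + 1 is at most K |y| |z|^k: one factor |y| is kept to provide
   the decay in n, the others are bounded by |z|. *)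
assert (Hf1 : forall n,
          (Cmod (f (z * p ^ n)%C - 1) <= K * Cmod (z * p ^ n) / (1 - Cmod z))%R).
{ intros n; set (y := z * p ^ n); specialize (Hy n); fold y in Hy.
  pose proof (is_Cseries_shift1 _ _ (Hf y ltac:(lra))) as H1.
  replace (term y O) with (RtoC 1) in H1
    by (unfold term; simpl; field; apply C1_nz).
  refine (is_Cseries_geom_le _ _ _ (Cmod z) _ _ H1).
  - split; [apply Cmod_ge_0 | exact Hz].
  - intros k; eapply Rle_trans; [apply Hterm|].
    rewrite Rmult_assoc; apply Rmult_le_compat_l; [exact HK0|].
    simpl; apply Rmult_le_compat_l; [apply Cmod_ge_0|].
    apply pow_incr; split; [apply Cmod_ge_0 | exact Hy]. }
assert (Hz0 : qpoch_inf z p <> 0).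
{ apply qpoch_inf_neq0; [exact Hp | now apply one_minus_mult_pow_neq0]. }
replace (qpoch_inf (a * z) p / qpoch_inf z p) with (f z); [now apply Hf|].
enough (E : f z * qpoch_inf z p = qpoch_inf (a * z) p)
  by (rewrite <- E; field; exact Hz0).
set (M := exp (Cmod (a * z) / (1 - Cmod p))).
refine (is_Clim_geom_close (fun n => f z * qpoch z p n) (qpoch (a * z) p) _ _
          (M * (K * Cmod z / (1 - Cmod z))) (Cmod p) _ _ _ _).
- split; [apply Cmod_ge_0 | exact Hp].
- exact (is_Clim_scal _ _ _ (qpoch_inf_correct z p Hp)).
- exact (qpoch_inf_correct (a * z) p Hp).
- intros n; rewrite Hrec.
  replace (qpoch (a * z) p n * f (z * p ^ n) - qpoch (a * z) p n)
    with (qpoch (a * z) p n * (f (z * p ^ n) - 1)) by ring.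
  rewrite Cmod_mult, Rmult_assoc.
  apply Rmult_le_compat; try apply Cmod_ge_0; [now apply qpoch_le_exp|].
  eapply Rle_trans; [apply Hf1|].
  rewrite Cmod_mult, Cmod_pow; right; field; lra.
Qed.

(* The numerator [(A z p^m)_oo] is kept whole: dividing out [(A z)_oo] to get a
   2phi1 on the right would fail when [A z p^n = 1] for some n. *)
Lemma heine_transformation (A B D p z l : C) :
  (Cmod p < 1)%R -> (Cmod B < 1)%R -> (Cmod z < 1)%R ->
  (forall n, 1 - D * B * p ^ n <> 0) ->
  is_Cseries (fun m => qpoch D p m / qpoch p p m * B ^ m
    * (qpoch_inf (A * (z * p ^ m)) p / qpoch_inf (z * p ^ m) p)) l ->
  is_Cseries (fun k => qpoch A p k * qpoch B p k
      / (qpoch p p k * qpoch (D * B) p k) * z ^ k)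
    (qpoch_inf B p / qpoch_inf (D * B) p * l).
Proof.
intros Hp HB Hz HDB Hl.
pose proof (one_minus_mult_pow_neq0 p p Hp Hp) as Hpp.
pose proof (one_minus_mult_pow_neq0 B p Hp HB) as HBp.
destruct (qpoch_ratio_bounded D p p Hp Hpp) as [K1 [HK10 HK1]].
destruct (qpoch_ratio_bounded A p p Hp Hpp) as [K2 [HK20 HK2]].
assert (H : is_Cseries (fun k => qpoch A p k / qpoch p p k * z ^ k
    * (qpoch_inf (D * (B * p ^ k)) p / qpoch_inf (B * p ^ k) p)) l).
(* The q-binomial theorem expands the quotient (A z p^m)_oo / (z p^m)_oo over k. As (p^m)^k =
   (p^k)^m, summing over m first is again a q-binomial series, with parameter D and argument B
   p^k. *)
{ refine (is_Cseries_exchange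
    (fun m k => qpoch D p m / qpoch p p m * B ^ m
       * (qpoch A p k / qpoch p p k * (z * p ^ m) ^ k))
    _ _ l (K1 * K2) (Cmod B) (Cmod z) _ _ _ _ _ Hl).
  - split; [apply Cmod_ge_0 | exact HB].
  - split; [apply Cmod_ge_0 | exact Hz].
  - intros m k; rewrite !Cmod_mult, !Cmod_pow.
    replace (K1 * K2 * Cmod B ^ m * Cmod z ^ k)%R
      with ((K1 * Cmod B ^ m) * (K2 * Cmod z ^ k))%R by ring.
    apply Rmult_le_compat.
    + apply Rmult_le_pos; [apply Cmod_ge_0 | apply pow_le, Cmod_ge_0].
    + apply Rmult_le_pos; [apply Cmod_ge_0 | apply pow_le, Cmod_ge_0].
    + apply Rmult_le_compat_r; [apply pow_le, Cmod_ge_0 | apply HK1].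
    + apply Rmult_le_compat; [apply Cmod_ge_0 | apply pow_le, Cmod_ge_0 | apply HK2|].
      apply pow_incr; split; [apply Cmod_ge_0 | now apply Cmod_mult_pow_le].
  - intros m; apply is_Cseries_scal, qbinomial; [exact Hp|].
    eapply Rle_lt_trans; [now apply Cmod_mult_pow_le | exact Hz].
  - intros k.
    assert (HBk : (Cmod (B * p ^ k) < 1)%R)
      by (eapply Rle_lt_trans; [now apply Cmod_mult_pow_le | exact HB]).
    refine (is_Cseries_ext _ _ _ _
              (is_Cseries_scal (qpoch A p k / qpoch p p k * z ^ k) _ _
                 (qbinomial D p (B * p ^ k) Hp HBk))).
    intros m; simpl.
    rewrite !Cpow_mult_l, <- !Cpow_mult_r, (Nat.mul_comm k m); ring. }
refine (is_Cseries_ext _ _ _ _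
          (is_Cseries_scal (qpoch_inf B p / qpoch_inf (D * B) p) _ _ H)).
intros k; simpl.
pose proof (qpoch_inf_neq0 _ p Hp HBp) as HB0.
pose proof (qpoch_inf_neq0 _ p Hp HDB) as HDB0.
rewrite (Cmult_assoc D B (p ^ k)).
(* Splitting also inside the nonvanishing facts makes the tails (B p^k)_oo and (D B p^k)_oo nonzero
   as factors of nonzero products. *)
rewrite (qpoch_inf_split B p k Hp) in HB0 |- *.
rewrite (qpoch_inf_split (D * B) p k Hp) in HDB0 |- *.
field; repeat split; try (now apply qpoch_neq0);
  intros E; [apply HB0 | apply HDB0]; rewrite E; ring.
Qed.

(** * Cubic products over third roots of unity and the 8W7 term *)

Lemma primitive_cube_root_sum (w : C) : primitive_root 3 w -> 1 + w + w ^ 2 = 0.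
Proof.
intros [H3 H]; specialize (H 1%nat ltac:(lia)).
apply NNPP; intros E.
apply (Cmult_neq_0 (w - 1) (1 + w + w ^ 2)).
- intros E1; apply H; replace (w ^ 1) with (w - 1 + 1) by ring; rewrite E1; ring.
- exact E.
- replace ((w - 1) * (1 + w + w ^ 2)) with (w ^ 3 - 1) by ring; rewrite H3; ring.
Qed.

(** Factor by factor this is (1-X)(1-wX)(1-w^2 X) = 1 - X^3, whose middle coefficients are multiples
    of 1 + w + w^2 = 0. *)
Lemma qpoch_cube (w x q : C) (k : nat) : primitive_root 3 w ->
  qpoch x q k * qpoch (w * x) q k * qpoch (w ^ 2 * x) q k
  = qpoch (x ^ 3) (q ^ 3) k.
Proof.
intros Hw; pose proof (primitive_cube_root_sum w Hw) as Hs; destruct Hw as [H3 _].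
induction k as [|k IH]; [simpl; ring|].
cbn [qpoch]; rewrite <- IH, <- Cpow_mult_r, (Nat.mul_comm 3 k), Cpow_mult_r.
set (y := q ^ k).
assert (E : (1 - x * y) * (1 - w * x * y) * (1 - w ^ 2 * x * y)
            = 1 - x ^ 3 * y ^ 3).
{ replace ((1 - x * y) * (1 - w * x * y) * (1 - w ^ 2 * x * y))
    with (1 - (1 + w + w ^ 2) * (x * y) + w * (1 + w + w ^ 2) * (x * y) ^ 2
          - w ^ 3 * (x * y) ^ 3) by ring.
  rewrite Hs, H3; ring. }
rewrite <- E; ring.
Qed.

Lemma Cmod_cube_lt1 (q : C) : (Cmod q < 1)%R -> (Cmod (q ^ 3) < 1)%R.
Proof.
intros Hq; rewrite Cmod_pow.
apply pow_lt_1_compat; [split; [apply Cmod_ge_0 | exact Hq] | lia].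
Qed.

(** Four triples collapse by [qpoch_cube]. The numerators a, wa, w^2 a give (a^3;q^3)_k, and r, wr,
    w^2 r give (q;q^3)_k. In the denominator, (q;q)_k joins qa/(wa) = w^2 q and qa/(w^2 a) = wq to
    give (q^3;q^3)_k. The other three start from qa/r = r^2 a, whose cube is q^2 a^3. *)
Lemma W87_term_cubic (q a w r : C) (k : nat) :
  (Cmod q < 1)%R -> q <> 0 -> a <> 0 -> 1 - a <> 0 ->
  primitive_root 3 w -> r ^ 3 = q ->
  (forall n : nat, 1 - q ^ 2 * a ^ 3 * (q ^ 3) ^ n <> 0) ->
  W87_term a (w * a) (w ^ 2 * a) r (w * r) (w ^ 2 * r) q q k =
  (1 - a * q ^ (2 * k)) / (1 - a)
  * (qpochs [q; a ^ 3] (q ^ 3) k / qpochs [q ^ 3; q ^ 2 * a ^ 3] (q ^ 3) k)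
  * q ^ k.
Proof.
intros Hq1 Hq0 Ha Ha1 Hw Hr Hden.
assert (Hw3 := proj1 Hw).
assert (Hw0 : w <> 0).
{ intros E; rewrite E in Hw3; apply C1_nz; rewrite <- Hw3; ring. }
assert (Hr0 : r <> 0).
{ intros E; apply Hq0; rewrite <- Hr, E; ring. }
assert (Hqq : qpoch (q ^ 3) (q ^ 3) k <> 0).
{ pose proof (Cmod_cube_lt1 q Hq1).
  now apply qpoch_neq0, one_minus_mult_pow_neq0. }
assert (Hqa : qpoch (q ^ 2 * a ^ 3) (q ^ 3) k <> 0) by now apply qpoch_neq0.
unfold W87_term, qpochs; cbn [map Cprod].
(* Because w^3 = 1, the inverse of w is w^2; this brings the denominator parameters to the shape
   required by [qpoch_cube]. *)
assert (D1 : forall x y : C, y <> 0 -> x / (w * y) = w ^ 2 * (x / y)).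
{ intros x y Hy; transitivity (w ^ 3 * x / (w * y)).
  - rewrite Hw3; field; repeat split; assumption.
  - field; repeat split; assumption. }
assert (D2 : forall x y : C, y <> 0 -> x / (w ^ 2 * y) = w * (x / y)).
{ intros x y Hy; transitivity (w ^ 3 * x / (w ^ 2 * y)).
  - rewrite Hw3; field; repeat split; assumption.
  - field; repeat split; assumption. }
rewrite !D1, !D2 by assumption.
replace (q * a / a) with q by (field; exact Ha).
replace (q * a / r) with (r ^ 2 * a) by (rewrite <- Hr; field; exact Hr0).
replace (q ^ 2 * a ^ 3) with ((r ^ 2 * a) ^ 3) in Hqa |- * by (rewrite <- Hr; ring).
rewrite <- (qpoch_cube w q q k Hw) in Hqq |- *.
rewrite <- (qpoch_cube w (r ^ 2 * a) q k Hw) in Hqa |- *.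
rewrite <- (qpoch_cube w a q k Hw).
replace (qpoch q (q ^ 3) k)
  with (qpoch r q k * qpoch (w * r) q k * qpoch (w ^ 2 * r) q k)
  by (rewrite (qpoch_cube w r q k Hw), Hr; reflexivity).
field.
repeat split; try exact Ha1; intros E;
  first [apply Hqq; rewrite E; ring | apply Hqa; rewrite E; ring].
Qed.

(** * Evaluation of the two 2phi1 series and conclusion *)

(** Heine's transformation is used with A = b, B = z = q, D = qb. Since D = Az, the product (D)_m (A
    z p^m)_oo is the constant (qb)_oo. What remains is the series of (q)_m/(p)_m q^m, summed by the
    q-binomial theorem to (q^2)_oo/(q)_oo. *)
Lemma phi21_gauss_cubic (q b : C) : (Cmod q < 1)%R ->
  (forall n : nat, 1 - q ^ 2 * b * (q ^ 3) ^ n <> 0) ->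
  is_Cseries (phi21_term q b (q ^ 2 * b) (q ^ 3) q)
    (qpochs_inf [q ^ 2; q * b] (q ^ 3)
     / (qpoch_inf (q ^ 2 * b) (q ^ 3) * qpoch_inf q (q ^ 3))).
Proof.
intros Hq Hc; pose proof (Cmod_cube_lt1 q Hq) as Hp.
set (p := q ^ 3) in *.
replace (q ^ 2 * b) with (q * b * q) in Hc |- * by ring.
pose proof (one_minus_mult_pow_neq0 q p Hp Hq) as Hqp.
pose proof (qpoch_inf_neq0 _ p Hp Hqp) as Hq0.
assert (Hpp : forall k, qpoch p p k <> 0)
  by (intros k; now apply qpoch_neq0, one_minus_mult_pow_neq0).
pose proof (is_Cseries_scal (qpoch_inf (q * b) p / qpoch_inf q p) _ _
              (qbinomial q p q Hp Hq)) as H.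
apply (is_Cseries_ext _ (fun m => qpoch (q * b) p m / qpoch p p m * q ^ m
         * (qpoch_inf (b * (q * p ^ m)) p / qpoch_inf (q * p ^ m) p))) in H.
- pose proof (heine_transformation b q (q * b) p q _ Hp Hq Hq Hc H) as H1.
  match type of H1 with is_series _ ?L =>
    replace (qpochs_inf [q ^ 2; q * b] p
             / (qpoch_inf (q * b * q) p * qpoch_inf q p)) with L end.
  + refine (is_Cseries_ext _ _ _ _ H1); intros k.
    unfold phi21_term, qpochs; cbn [map Cprod].
    field; split; [now apply qpoch_neq0 | apply Hpp].
  + unfold qpochs_inf; cbn [map Cprod].
    replace (q ^ 2) with (q * q) by ring.
    field; split; [exact Hq0 | now apply qpoch_inf_neq0].
- intros m.
  replace (b * (q * p ^ m)) with (q * b * p ^ m) by ring.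
  rewrite (qpoch_inf_split (q * b) p m Hp).
  rewrite (qpoch_inf_split q p m Hp) in Hq0 |- *.
  field; repeat split; [| apply Hpp | now apply qpoch_neq0].
  intros E; apply Hq0; rewrite E; ring.
Qed.

(** Same A, B, D, now with z = p = q^3. Then (p p^m)_oo = (p)_oo/(p)_m and (b p p^m)_oo =
    (pb)_oo/(pb)_m, so the transformed terms are a constant times (qb)_m/(pb)_m q^m. This is the
    2phi1 on the right, as its parameter p cancels the (p)_m below. *)
Lemma phi21_heine_cubic (q b : C) : (Cmod q < 1)%R ->
  (forall n : nat, 1 - q ^ 2 * b * (q ^ 3) ^ n <> 0) ->
  (forall n : nat, 1 - q ^ 3 * b * (q ^ 3) ^ n <> 0) ->
  exists l : C,
    is_Cseries (phi21_term (q * b) (q ^ 3) (q ^ 3 * b) (q ^ 3) q) l /\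
    is_Cseries (phi21_term q b (q ^ 2 * b) (q ^ 3) (q ^ 3))
      (qpochs_inf [q; q ^ 3 * b] (q ^ 3)
       / (qpoch_inf (q ^ 2 * b) (q ^ 3) * qpoch_inf (q ^ 3) (q ^ 3)) * l).
Proof.
intros Hq Hc Hd; pose proof (Cmod_cube_lt1 q Hq) as Hp.
set (p := q ^ 3) in *.
replace (q ^ 2 * b) with (q * b * q) in Hc |- * by ring.
pose proof (one_minus_mult_pow_neq0 p p Hp Hp) as Hpp.
pose proof (qpoch_inf_neq0 _ p Hp Hpp) as Hp0.
pose proof (qpoch_inf_neq0 _ p Hp Hd) as Hd0.
assert (Hppk : forall k, qpoch p p k <> 0) by (intros k; now apply qpoch_neq0).
assert (Hdk : forall k, qpoch (p * b) p k <> 0) by (intros k; now apply qpoch_neq0).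
assert (Hl : exists l, is_Cseries (phi21_term (q * b) p (p * b) p q) l).
{ destruct (qpoch_ratio_bounded (q * b) (p * b) p Hp Hd) as [K [_ HK]].
  apply ex_Cseries_geom with K (Cmod q).
  - split; [apply Cmod_ge_0 | exact Hq].
  - intros n; unfold phi21_term, qpochs; cbn [map Cprod].
    replace (qpoch (q * b) p n * (qpoch p p n * 1)
             / (qpoch p p n * (qpoch (p * b) p n * 1)))
      with (qpoch (q * b) p n / qpoch (p * b) p n)
      by (field; split; [apply Hdk | apply Hppk]).
    rewrite Cmod_mult, Cmod_pow.
    apply Rmult_le_compat_r; [apply pow_le, Cmod_ge_0 | apply HK]. }
destruct Hl as [l Hl]; exists l; split; [exact Hl|].
pose proof (is_Cseries_scal (qpoch_inf (p * b) p / qpoch_inf p p) _ _ Hl) as H.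
apply (is_Cseries_ext _ (fun m => qpoch (q * b) p m / qpoch p p m * q ^ m
         * (qpoch_inf (b * (p * p ^ m)) p / qpoch_inf (p * p ^ m) p))) in H.
- pose proof (heine_transformation b q (q * b) p p _ Hp Hq Hp Hc H) as H1.
  match type of H1 with is_series _ ?L =>
    replace (qpochs_inf [q; p * b] p
             / (qpoch_inf (q * b * q) p * qpoch_inf p p) * l) with L end.
  + refine (is_Cseries_ext _ _ _ _ H1); intros k.
    unfold phi21_term, qpochs; cbn [map Cprod].
    field; split; [now apply qpoch_neq0 | apply Hppk].
  + unfold qpochs_inf; cbn [map Cprod].
    field; split; [exact Hp0 | now apply qpoch_inf_neq0].
- intros m; unfold phi21_term, qpochs; cbn [map Cprod].
  replace (b * (p * p ^ m)) with (p * b * p ^ m) by ring.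
  rewrite (qpoch_inf_split (p * b) p m Hp).
  rewrite (qpoch_inf_split p p m Hp) in Hp0 |- *.
  field; repeat split; try apply Hppk; try apply Hdk.
  intros E; apply Hp0; rewrite E; ring.
Qed.

(** The branch of q^(1/3) is an arbitrary cube root [r]. Convergence is asserted alongside the
    identities because [Cseries] is meaningful only for convergent series. *)
Theorem corollary3p9 (q a w r : C)
  (hq0 : (0 < Cmod q)%R) (hq1 : (Cmod q < 1)%R)
  (ha : a <> 0)
  (hw : primitive_root 3 w)
  (hr : r ^ 3 = q)
  (hden1 : 1 - a <> 0)
  (hden2 : forall n : nat, 1 - q ^ 2 * a ^ 3 * (q ^ 3) ^ n <> 0)
  (hden3 : forall n : nat, 1 - q ^ 3 * a ^ 3 * (q ^ 3) ^ n <> 0) :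
  let mid := fun k : nat =>
    (1 - a * q ^ (2 * k)) / (1 - a)
    * (qpochs [q; a ^ 3] (q ^ 3) k / qpochs [q ^ 3; q ^ 2 * a ^ 3] (q ^ 3) k)
    * q ^ k in
  ex_Cseries (W87_term a (w * a) (w ^ 2 * a) r (w * r) (w ^ 2 * r) q q) /\
  ex_Cseries mid /\
  ex_Cseries (phi21_term (q * a ^ 3) (q ^ 3) (q ^ 3 * a ^ 3) (q ^ 3) q) /\
  W87 a (w * a) (w ^ 2 * a) r (w * r) (w ^ 2 * r) q q = Cseries mid /\
  Cseries mid =
    1 / ((1 - a) * qpoch_inf (q ^ 2 * a ^ 3) (q ^ 3))
    * (qpochs_inf [q ^ 2; q * a ^ 3] (q ^ 3) / qpoch_inf q (q ^ 3)
       - a * qpochs_inf [q; q ^ 3 * a ^ 3] (q ^ 3) / qpoch_inf (q ^ 3) (q ^ 3)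
         * phi21 (q * a ^ 3) (q ^ 3) (q ^ 3 * a ^ 3) (q ^ 3) q).
Proof.
intros mid.
assert (Hq : q <> 0) by (intros E; rewrite E, Cmod_0 in hq0; lra).
assert (HW : forall k, mid k
               = W87_term a (w * a) (w ^ 2 * a) r (w * r) (w ^ 2 * r) q q k)
  by (intros k; symmetry; now apply W87_term_cubic).
pose proof (phi21_gauss_cubic q (a ^ 3) hq1 hden2) as H1.
destruct (phi21_heine_cubic q (a ^ 3) hq1 hden2 hden3) as [l [Hl H2]].
pose proof (is_Cseries_minus _ _ _ _ (is_Cseries_scal (1 / (1 - a)) _ _ H1)
              (is_Cseries_scal (a / (1 - a)) _ _ H2)) as Hs.
apply (is_Cseries_ext _ mid) in Hs.
(* Splitting 1 - a q^(2k) leaves arguments q and q^3, the latter from q^(2k) q^k = (q^3)^k. *)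
2: { intros k; unfold mid, phi21_term.
     rewrite <- Cpow_mult_r; replace (3 * k)%nat with (2 * k + k)%nat by lia.
     rewrite Cpow_add_r; unfold Cdiv; ring. }
split; [|split; [|split; [|split]]].
- eexists; exact (is_Cseries_ext _ _ _ HW Hs).
- eexists; exact Hs.
- eexists; exact Hl.
- unfold W87; rewrite (Cseries_unique _ _ Hs).
  apply Cseries_unique; exact (is_Cseries_ext _ _ _ HW Hs).
- rewrite (Cseries_unique _ _ Hs).
  unfold phi21; rewrite (Cseries_unique _ _ Hl).
  pose proof (Cmod_cube_lt1 q hq1) as Hp.
  field; repeat split; try exact hden1; apply qpoch_inf_neq0; trivial;
    now apply one_minus_mult_pow_neq0.
Qed.
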